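(* Let $\{x_k\}_{k\ge 0}$ be a sequence of iterates computed by the variable sample spectral gradient algorithm described in the context, with $\sum_{k\geq 0}\zeta_k=\bar\zeta<+\infty$. Assume that $\sum_{k\geq 0}\nu_k=\bar\nu<+\infty$, that the gradients $\nabla f_j$, $j=1,\dots,N$, are Lipschitz-continuous on $\mathbb R^n$ with constant $L>0$, and let $x_*$ be a global minimizer of $f_{\mathcal N}$. Then for any given $\varepsilon>0$ the generated sequence satisfies $$\|\nabla f_{\mathcal N_k}(x_k)\|\le\varepsilon$$ in at most $$k_\varepsilon=\left\lceil\big(f_{\mathcal N}(x_0)-f_{\mathcal N}(x_* )+\bar\zeta+2\bar\nu\big)\,C^{-1}\varepsilon^{-2}\right\rceil$$ iterations (that is, the inequality holds for some index $k$ with $0\le k\le k_\varepsilon$), where $C=-\frac{c_1(c_2-1)}{L}$.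
   Context: Problem. $f_1,\dots,f_N:\mathbb R^n\to\mathbb R$ are continuously differentiable, $\mathcal N=\{1,\dots,N\}$, and $f_{\mathcal N}(x)=\frac1N\sum_{j=1}^N f_j(x)$. For a nonempty $\mathcal S\subseteq\mathcal N$ put $f_{\mathcal S}(x)=\frac1{|\mathcal S|}\sum_{j\in\mathcal S}f_j(x)$ and $\nabla f_{\mathcal S}(x)=\frac1{|\mathcal S|}\sum_{j\in\mathcal S}\nabla f_j(x)$. $\|\cdot\|$ is the Euclidean norm. Algorithm (variable sample spectral gradient framework). Fixed parameters: $0<\sigma_m<1<\sigma_M<+\infty$, $0<c_1\le c_2<1$, and $\zeta_k>0$ with $\sum_{k\ge0}\zeta_k<+\infty$. Start from $x_0\in\mathbb R^n$, an initial nonempty subsample $\mathcal N_0\subseteq\mathcal N$ of size $N_0$, and an initial coefficient $\sigma_{-1}\in[\sigma_m,\sigma_M]$. At each iteration $k$: 1. (for $k\ge1$) A sample size $N_k\ge N_{k-1}$ and a (randomly generated) subsample $\mathcal N_k\subseteq\mathcal N$ with $|\mathcal N_k|=N_k$ are chosen, according to one of two subsampling rules, fixed for the whole run: nested, i.e. $\mathcal N_{k-1}\subseteq\mathcal N_k$; or non-nested, with the requirement $\mathcal N_{k-1}\cap\mathcal N_k\ne\emptyset$. The statement concerns any resulting realization of the subsamples. 2. (for $k\ge1$) Set $s_{k-1}=x_k-x_{k-1}$ and compute $y_{k-1}$ by one of the following formulas, fixed for the whole run: $y_{k-1}=\nabla f_{\mathcal N_k}(x_k)-\nabla f_{\mathcal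 N_k}(x_{k-1})$ (nested or non-nested case); $y_{k-1}=\nabla f_{\mathcal N_k}(x_k)-\nabla f_{\mathcal N_{k-1}}(x_{k-1})$ (nested case only); $y_{k-1}=\nabla f_{\mathcal I_k}(x_k)-\nabla f_{\mathcal I_k}(x_{k-1})$ with $\mathcal I_k=\mathcal N_k\cap\mathcal N_{k-1}$ (non-nested case only). Set $\sigma_{k-1}=\frac{s_{k-1}^ty_{k-1}}{s_{k-1}^ts_{k-1}}$ if this quantity is defined and lies in $[\sigma_m,\sigma_M]$, and $\sigma_{k-1}=1$ otherwise. 3. Set $d_k=-\sigma_{k-1}^{-1}\nabla f_{\mathcal N_k}(x_k)$. 4. Take a steplength $\alpha_k>0$ satisfying both $$f_{\mathcal N_k}(x_k+\alpha_kd_k)\le f_{\mathcal N_k}(x_k)+c_1\alpha_k\nabla f_{\mathcal N_k}(x_k)^td_k+\zeta_k,$$ $$\nabla f_{\mathcal N_k}(x_k+\alpha_kd_k)^td_k\ge c_2\nabla f_{\mathcal N_k}(x_k)^td_k.$$ 5. Set $x_{k+1}=x_k+\alpha_kd_k$. Approximation error. For each $k\ge0$, $$\nu_k=\max\{|f_{\mathcal N_k}(x_k)-f_{\mathcal N}(x_k)|,\ |f_{\mathcal N_k}(x_{k+1})-f_{\mathcal N}(x_{k+1})|\}.$$ *)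

(* Defs.v *)
From HB Require Import structures.
From mathcomp Require Import all_boot all_order all_algebra.
From mathcomp Require Import all_classical all_reals all_analysis.
Export numFieldNormedType.Exports.

Set Implicit Arguments.
Unset Strict Implicit.
Unset Printing Implicit Defensive.

Import Order.TTheory GRing.Theory Num.Theory.
Local Open Scope classical_set_scope.
Local Open Scope ring_scope.

Section Euclidean.
Context {R : realType} {n : nat}.
Implicit Types (u v x y : 'rV[R]_n) (f : 'rV[R]_n -> R).

Definition dotr u v : R := \sum_(i < n) u 0 i * v 0 i.

(* The library norm `|u| on 'rV[R]_n is the sup norm. *)
Definition norm2 u : R := Num.sqrt (dotr u u).

Definition grad f x : 'rV[R]_n := \row_(i < n) 'D_(delta_mx 0 i) f x.

Definition continuously_differentiable f : Prop :=
  (forall x, differentiable f x) /\ continuous (grad f).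

Definition lipschitz_gradient (L : R) f : Prop :=
  forall x y, norm2 (grad f x - grad f y) <= L * norm2 (x - y).

End Euclidean.

Section Subsampling.
Context {R : realType} {n N : nat}.
Variable f : 'I_N -> 'rV[R]_n -> R.

Definition f_avg (S : {set 'I_N}) (x : 'rV[R]_n) : R :=
  (#|S|%:R)^-1 * \sum_(j in S) f j x.

Definition grad_avg (S : {set 'I_N}) (x : 'rV[R]_n) : 'rV[R]_n :=
  (#|S|%:R)^-1 *: \sum_(j in S) grad (f j) x.

Definition f_full : 'rV[R]_n -> R := f_avg [set: 'I_N].

Definition approx_error (S : nat -> {set 'I_N}) (x : nat -> 'rV[R]_n)
    (k : nat) : R :=
  Num.max `|f_avg (S k) (x k) - f_full (x k)|
          `|f_avg (S k) (x k.+1) - f_full (x k.+1)|.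

End Subsampling.

Inductive sampling_rule := Nested | NonNested.

Definition sampling_step N (rule : sampling_rule) (S S' : {set 'I_N}) : Prop :=
  match rule with
  | Nested => S \subset S'
  | NonNested => (S :&: S')%SET != finset.set0
  end.

Inductive y_formula := YCurrent | YConsecutive | YCommon.

Definition y_allowed (rule : sampling_rule) (yf : y_formula) : Prop :=
  match yf with
  | YCurrent => True
  | YConsecutive => rule = Nested
  | YCommon => rule = NonNested
  end.

Section Algorithm.
Context {R : realType} {n N : nat}.

(* S and x are the previous subsample and iterate, S' and x' the current
   ones. *)
Definition y_vector (f : 'I_N -> 'rV[R]_n -> R) (yf : y_formula)
    (S S' : {set 'I_N}) (x x' : 'rV[R]_n) : 'rV[R]_n :=
  match yf with
  | YCurrent => grad_avg f S' x' - grad_avg f S' x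
  | YConsecutive => grad_avg f S' x' - grad_avg f S x
  | YCommon =>
      grad_avg f (S' :&: S)%SET x' - grad_avg f (S' :&: S)%SET x
  end.

Definition spectral_coef (sigma_m sigma_M : R) (s y : 'rV[R]_n) : R :=
  let r := dotr s y / dotr s s in
  if (dotr s s != 0) && (sigma_m <= r <= sigma_M) then r else 1.

(* The coefficient used in iteration k, written sigma_{k-1} in the
   literature, is [sigma k]; so [sigma 0] is the initial coefficient. *)
Record spectral_gradient_run (f : 'I_N -> 'rV[R]_n -> R)
    (rule : sampling_rule) (yf : y_formula)
    (sigma_m sigma_M c1 c2 : R) (zeta : nat -> R)
    (S : nat -> {set 'I_N}) (sigma alpha : nat -> R)
    (x d : nat -> 'rV[R]_n) : Prop := SpectralGradientRun {
  run_S0 : S 0%N != finset.set0;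
  run_size : forall k, (#|S k| <= #|S k.+1|)%N;
  run_sampling : forall k, sampling_step rule (S k) (S k.+1);
  run_sigma0 : sigma_m <= sigma 0%N <= sigma_M;
  run_sigma : forall k, sigma k.+1 =
    spectral_coef sigma_m sigma_M (x k.+1 - x k)
      (y_vector f yf (S k) (S k.+1) (x k) (x k.+1));
  run_direction : forall k, d k = - ((sigma k)^-1 *: grad_avg f (S k) (x k));
  run_alpha_gt0 : forall k, 0 < alpha k;
  run_armijo : forall k,
    f_avg f (S k) (x k + alpha k *: d k) <=
    f_avg f (S k) (x k) + c1 * alpha k * dotr (grad_avg f (S k) (x k)) (d k)
      + zeta k;
  run_wolfe : forall k,
    c2 * dotr (grad_avg f (S k) (x k)) (d k) <=
    dotr (grad_avg f (S k) (x k + alpha k *: d k)) (d k);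
  run_update : forall k, x k.+1 = x k + alpha k *: d k
}.

End Algorithm.

(* Main.v *)
(** Since the coefficient is positive, the Wolfe condition and the Lipschitz
    continuity of the gradient give [alpha_k >= (1 - c2) sigma_{k-1} / L] as
    soon as the sampled gradient [g_k] is nonzero, so the relaxed Armijo
    condition decreases the sampled function by at least
    [C |g_k|^2 - zeta_k]. Passing to the full function costs [nu_k] at each
    end of the step; telescoping bounds [C * sum_k |g_k|^2] by
    [f(x_0) - f(x_star) + zeta_bar + 2 nu_bar]. *)
Require Import Defs.
From mathcomp Require Import all_boot all_order all_algebra.
From mathcomp Require Import all_classical all_reals all_analysis.
From mathcomp Require Import ring lra.
Import Order.TTheory GRing.Theory Num.Theory.
Local Open Scope classical_set_scope.
Local Open Scope ring_scope.

Section DotProduct.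
Context {R : realType} {n : nat}.
Implicit Types (u v w : 'rV[R]_n) (a : R).

Lemma dotrC u v : dotr u v = dotr v u.
Proof. by apply: eq_bigr => i _; rewrite mulrC. Qed.

Lemma dotrDl u v w : dotr (u + v) w = dotr u w + dotr v w.
Proof.
by rewrite /dotr -big_split; apply: eq_bigr => i _; rewrite mxE mulrDl.
Qed.

Lemma dotrZl a u v : dotr (a *: u) v = a * dotr u v.
Proof. by rewrite /dotr mulr_sumr; apply: eq_bigr => i _; rewrite mxE mulrA. Qed.

Lemma dotrNl u v : dotr (- u) v = - dotr u v.
Proof. by rewrite -scaleN1r dotrZl mulN1r. Qed.

Lemma dotrZr a u v : dotr u (a *: v) = a * dotr u v.
Proof. by rewrite dotrC dotrZl dotrC. Qed.

Lemma dotrNr u v : dotr u (- v) = - dotr u v.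
Proof. by rewrite dotrC dotrNl dotrC. Qed.

Lemma dotr_suml (I : Type) (r : seq I) (P : pred I) (F : I -> 'rV[R]_n) v :
  dotr (\sum_(i <- r | P i) F i) v = \sum_(i <- r | P i) dotr (F i) v.
Proof.
apply: (big_morph (fun u => dotr u v)) => [u w|]; first exact: dotrDl.
by rewrite /dotr big1 // => i _; rewrite mxE mul0r.
Qed.

Lemma dotr_ge0 u : 0 <= dotr u u.
Proof. by apply: sumr_ge0 => i _; rewrite -expr2 sqr_ge0. Qed.

Lemma sqr_norm2 u : norm2 u ^+ 2 = dotr u u.
Proof. by rewrite sqr_sqrtr // dotr_ge0. Qed.

Lemma norm2_ge0 u : 0 <= norm2 u.
Proof. exact: sqrtr_ge0. Qed.

Lemma norm2Z a u : 0 <= a -> norm2 (a *: u) = a * norm2 u.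
Proof.
move=> a0; apply/eqP; rewrite -(@eqrXn2 _ 2) ?norm2_ge0 ?mulr_ge0 ?norm2_ge0 //.
by rewrite exprMn !sqr_norm2 dotrZl dotrZr; apply/eqP; ring.
Qed.

(* Expand [|u - a v|^2 >= 0]. *)
Lemma dotr_le_of_norm2 u v a :
  0 < a -> norm2 u <= a * norm2 v -> dotr u v <= a * dotr v v.
Proof.
move=> a0 uv; have {}uv : dotr u u <= a ^+ 2 * dotr v v.
  rewrite -!sqr_norm2 -exprMn; apply: lerXn2r uv => //.
    by rewrite nnegrE norm2_ge0.
  by rewrite nnegrE mulr_ge0 ?norm2_ge0 // ltW.
have := dotr_ge0 (u - a *: v).
rewrite dotrDl dotrNl dotrZl !(dotrC _ (u - _)) !dotrDl !dotrNl !dotrZl (dotrC v u).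
move=> h; rewrite -(ler_pM2l a0); nra.
Qed.

End DotProduct.

Section Descent.
Context {R : realType} {n N : nat}.
Variables (f : 'I_N -> 'rV[R]_n -> R) (L : R).
Hypotheses (L0 : 0 < L) (lipf : forall j, lipschitz_gradient L (f j)).

(** The bound holds for each [f j] separately, by [dotr_le_of_norm2] with constant [L * a], and
    averaging over a nonempty [A] preserves it. It is the upper bound set against the Wolfe
    condition. *)
Lemma grad_avg_dotr_le (A : {set 'I_N}) (x d : 'rV[R]_n) (a : R) :
  A != finset.set0 -> 0 < a ->
  dotr (grad_avg f A (x + a *: d)) d - dotr (grad_avg f A x) d
    <= L * a * dotr d d.
Proof.
move=> A0 a0; have cA : 0 < #|A|%:R :> R by rewrite ltr0n card_gt0.
rewrite /grad_avg !dotrZl !dotr_suml -mulrBr -sumrB mulrC ler_pdivrMr //.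
(* The right-hand side becomes a constant sum over [A], so the comparison is termwise. *)
rewrite [leRHS]mulrC mulr_natl -sumr_const; apply: ler_sum => j _.
rewrite -dotrNl -dotrDl; apply: dotr_le_of_norm2; first by rewrite mulr_gt0.
apply: le_trans (lipf j _ _) _.
by rewrite addrC addKr norm2Z ?(ltW a0) // mulrA.
Qed.

Lemma wolfe_armijo_decrease (A : {set 'I_N}) (x : 'rV[R]_n) (c1 c2 s a z : R) :
  A != finset.set0 -> 0 < c1 -> 0 < s -> 0 < a ->
  let g := grad_avg f A x in
  let d := - (s^-1 *: g) in
  c2 * dotr g d <= dotr (grad_avg f A (x + a *: d)) d ->
  f_avg f A (x + a *: d) <= f_avg f A x + c1 * a * dotr g d + z ->
  f_avg f A (x + a *: d) <=
    f_avg f A x - - (c1 * (c2 - 1) / L) * norm2 g ^+ 2 + z.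
Proof.
move=> A0 c10 s0 a0 g d wolfe armijo; apply: le_trans armijo _.
rewrite lerD2r lerD2l sqr_norm2.
have gd : dotr g d = - (s^-1 * dotr g g) by rewrite dotrNr dotrZr.
have dd : dotr d d = s^-1 * (s^-1 * dotr g g).
  by rewrite dotrNr dotrNl opprK dotrZr dotrZl.
have := grad_avg_dotr_le A x d a A0 a0; rewrite -/g => lip.
(* Subtract [dotr g d] from both sides of the Wolfe condition and compare with the Lipschitz
   bound. *)
have {wolfe}lip : (1 - c2) * (s^-1 * dotr g g) <= L * a * (s^-1 * (s^-1 * dotr g g)).
  rewrite gd in lip wolfe; rewrite dd in lip; lra.
rewrite gd.
(* This is the lower bound on the steplength with the factor [dotr g g] kept on both sides, so that
   [g = 0] is no separate case. *)
have {}lip : (1 - c2) / L * dotr g g <= a * (s^-1 * dotr g g).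
  rewrite mulrAC ler_pdivrMr // -(ler_pM2l (_ : 0 < s^-1)) ?invr_gt0 //.
  by apply: le_trans (_ : _ <= (1 - c2) * (s^-1 * dotr g g)) _; lra.
have := ler_wpM2l (ltW c10) lip; lra.
Qed.

End Descent.

Section Run.
Context {R : realType} {n N : nat}.
Variables (f : 'I_N -> 'rV[R]_n -> R) (rule : sampling_rule) (yf : y_formula).
Variables (sigma_m sigma_M c1 c2 L : R) (zeta : nat -> R).
Variables (S : nat -> {set 'I_N}) (sigma alpha : nat -> R).
Variables (x d : nat -> 'rV[R]_n).
Hypotheses (sm0 : 0 < sigma_m) (c10 : 0 < c1) (L0 : 0 < L).
Hypothesis lipf : forall j, lipschitz_gradient L (f j).
Hypothesis run :
  spectral_gradient_run f rule yf sigma_m sigma_M c1 c2 zeta S sigma alpha x d.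

(** Sample sizes never decrease, so nonemptiness propagates from [S 0]. *)
Lemma run_sample_neq0 k : S k != finset.set0.
Proof.
elim: k => [|k IH]; first exact: run_S0 run.
rewrite -card_gt0; apply: leq_trans (run_size run k).
by rewrite card_gt0.
Qed.

(** A coefficient is either at least [sigma_m] or the default value 1. *)
Lemma run_sigma_gt0 k : 0 < sigma k.
Proof.
case: k => [|k].
  by case/andP: (run_sigma0 run) => sm _; apply: lt_le_trans sm.
rewrite (run_sigma run) /spectral_coef; case: ifP => // /and3P[_ sm _].
exact: lt_le_trans sm.
Qed.

Lemma approx_error_ge0 k : 0 <= approx_error f S x k.
Proof. by rewrite /approx_error le_max normr_ge0. Qed.

Lemma run_decrease k :
  f_full f (x k.+1) <= f_full f (x k)
    - - (c1 * (c2 - 1) / L) * norm2 (grad_avg f (S k) (x k)) ^+ 2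
    + zeta k + 2 * approx_error f S x k.
Proof.
have := wolfe_armijo_decrease f L L0 lipf (S k) (x k) c1 c2 (sigma k)
  (alpha k) (zeta k) (run_sample_neq0 k) c10 (run_sigma_gt0 k)
  (run_alpha_gt0 run k).
rewrite /= -(run_direction run) -(run_update run).
have := run_wolfe run k; have := run_armijo run k; rewrite -(run_update run).
move=> armijo wolfe /(_ wolfe armijo) dec.
have e1 : `|f_avg f (S k) (x k) - f_full f (x k)| <= approx_error f S x k.
  by rewrite /approx_error le_max lexx.
have e2 : `|f_avg f (S k) (x k.+1) - f_full f (x k.+1)| <= approx_error f S x k.
  by rewrite /approx_error le_max lexx orbT.
(* One side of each absolute value is kept: the sampled function is at most [f_full] plus the error
   at [x k], and at least [f_full] minus the error at [x k.+1]. *)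
move: e1 e2; rewrite !ler_norml => /andP[_ e1] /andP[e2 _]; lra.
Qed.

Lemma run_sum_sqr_grad K :
  - (c1 * (c2 - 1) / L) *
      (\sum_(0 <= k < K) norm2 (grad_avg f (S k) (x k)) ^+ 2)
    <= f_full f (x 0%N) - f_full f (x K) + series zeta K
       + 2 * series (approx_error f S x) K.
Proof.
elim: K => [|K IH].
  by rewrite /series /= !big_geq // !mulr0 !addr0 subrr.
rewrite !seriesSr big_nat_recr //= mulrDr; have := run_decrease K; lra.
Qed.

End Run.

(** Partial sums of nonnegative terms increase to their limit. *)
Lemma series_le_cvg (R : realType) (u : nat -> R) (l : R) K :
  (forall k, 0 <= u k) -> series u @ \oo --> l -> series u K <= l.
Proof.
move=> u0 cu; rewrite -(cvg_lim (@Rhausdorff R) cu).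
apply: nondecreasing_cvgn_le; last by apply: cvgP cu.
by apply/nondecreasing_seqP => k; rewrite seriesSr lerDl.
Qed.

Theorem theorem3p2 (R : realType) (n N : nat) (f : 'I_N -> 'rV[R]_n -> R)
  (rule : sampling_rule) (yf : y_formula)
  (sigma_m sigma_M c1 c2 L zeta_bar nu_bar : R) (zeta : nat -> R)
  (S : nat -> {set 'I_N}) (sigma alpha : nat -> R) (x d : nat -> 'rV[R]_n)
  (xstar : 'rV[R]_n) :
  (forall j, continuously_differentiable (f j)) ->
  y_allowed rule yf ->
  0 < sigma_m < 1 -> 1 < sigma_M ->
  0 < c1 -> c1 <= c2 -> c2 < 1 ->
  (forall k, 0 < zeta k) ->
  series zeta @ \oo --> zeta_bar ->
  spectral_gradient_run f rule yf sigma_m sigma_M c1 c2 zeta S sigma alpha x d ->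
  series (approx_error f S x) @ \oo --> nu_bar ->
  0 < L ->
  (forall j, lipschitz_gradient L (f j)) ->
  (forall z, f_full f xstar <= f_full f z) ->
  forall eps : R, 0 < eps ->
  let C := - (c1 * (c2 - 1) / L) in
  let k_eps := Num.ceil ((f_full f (x 0%N) - f_full f xstar
                          + zeta_bar + 2 * nu_bar) * C^-1 * eps ^- 2) in
  exists k : nat, k%:Z <= k_eps /\ norm2 (grad_avg f (S k) (x k)) <= eps.
Proof.
move=> _ _ /andP[sm0 _] _ c10 _ c21 zeta0 czeta run cnu L0 lipf xmin eps eps0 C.
set Q := f_full f (x 0%N) - _ + _ + _; move=> k_eps.
have C0 : 0 < C by rewrite /C -mulNr -mulrN opprB !mulr_gt0 ?subr_gt0 ?invr_gt0.
have bound K : C * (\sum_(0 <= k < K) norm2 (grad_avg f (S k) (x k)) ^+ 2) <= Q.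
  apply: le_trans (run_sum_sqr_grad _ _ _ _ _ _ _ _ _ _ _ _ _ _ sm0 c10 L0 lipf run K) _.
  have := xmin (x K).
  have := series_le_cvg _ _ _ K (fun k => ltW (zeta0 k)) czeta.
  have := series_le_cvg _ _ _ K (approx_error_ge0 f S x) cnu.
  rewrite /Q; lra.
(* The empty sum gives the sign of [Q]; hence the integer [k_eps] is nonnegative and equals some
   natural number [K]. *)
have Q0 : 0 <= Q by have := bound 0%N; rewrite big_geq // mulr0.
have k0 : 0 <= k_eps.
  rewrite -(ceil0 R); apply: ceil_le; rewrite !mulr_ge0 ?invr_ge0 ?exprn_ge0 ?(ltW C0) ?(ltW eps0) //.
have [K kE] : exists K : nat, k_eps = K%:Z by exists `|k_eps|%N; rewrite gez0_abs.
have QK : Q <= K%:R * (C * eps ^+ 2).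
  rewrite -ler_pdivrMr ?mulr_gt0 ?exprn_gt0 // invfM mulrA.
  by apply: le_trans (ceil_ge _) _; rewrite -/k_eps kE.
case: (pselect (exists k, (k <= K)%N /\ norm2 (grad_avg f (S k) (x k)) <= eps)).
  by case=> k [kK gk]; exists k; rewrite kE lez_nat.
move=> nex; exfalso.
(* The indices from 0 to [K] contribute [K.+1] terms, each at least [eps ^+ 2]. This one extra term
   contradicts [QK], where only [K] occurs. *)
have : K.+1%:R * (C * eps ^+ 2) <= Q.
  apply: le_trans (bound K.+1); rewrite mulrCA ler_pM2l //.
  rewrite mulr_natl -[X in _ *+ X]subn0 -sumr_const_nat big_nat [leRHS]big_nat.
  apply: ler_sum => k /= kK; rewrite lerXn2r ?nnegrE ?norm2_ge0 ?(ltW eps0) //.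
  by rewrite leNgt; apply/negP => /ltW gk; apply: nex; exists k.
move=> /le_trans /(_ QK); rewrite ler_pM2r ?mulr_gt0 ?exprn_gt0 //.
by rewrite ler_nat ltnn.
Qed.
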